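(* The class $\mathcal{A}uto$ is a proper subclass of the class $\mathcal{S}ymm$; that is, $\mathcal{A}uto \subseteq \mathcal{S}ymm$ and there exists a graph in $\mathcal{S}ymm$ that is not in $\mathcal{A}uto$.
   Context: All graphs are finite simple graphs. Given a graph $G$, two players $\mathcal{A}$ and $\mathcal{B}$ alternately color edges of $G$, $\mathcal{A}$ in red and $\mathcal{B}$ in blue, with $\mathcal{A}$ moving first; in each move a player colors one so-far uncolored edge. The $i$-th round consists of the $i$-th move of $\mathcal{A}$ followed by the $i$-th move of $\mathcal{B}$. A strategy for a player is a function assigning to each sequence of the opponent's previous moves a legal (uncolored) edge to color next. Let $A_i$ (resp. $B_i$) be the set of red (resp. blue) edges colored in the first $i$ rounds. A symmetric strategy of $\mathcal{B}$ on $G$ is a strategy of $\mathcal{B}$ ensuring that, irrespective of $\mathcal{A}$'s strategy, the subgraphs with edge sets $A_i$ and $B_i$ are isomorphic for every $i \le m/2$, where $m$ is the number of edges of $G$. $\mathcal{S}ymm$ denotes the class of all graphs $G$ on which $\mathcal{B}$ has a symmetric strategy. An automorphism $\phi$ of $G$ induces a permutation $\phi'$ of $E(G)$ by $\phi'(\{u,v\})=\{\phi(u),\phi(v)\}$; $\phi$ is involutory if it has order 2. $\mathcal{A}uto$ denotes the class of all graphs $G$ having an involutory automorphism $\phi$ such that $\phi'$ has no fixed edge (equivalently, on which $\mathcal{B}$ has the automorphism-based strategy of answering each red edge $e$ by the blue edge $\phi'(e)$). *)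

(* Defs.v *)
From mathcomp Require Import all_boot all_fingroup.

Set Implicit Arguments.
Unset Strict Implicit.
Unset Printing Implicit Defensive.

Record sgraph := SGraph {
  vertex :> finType;
  adj : rel vertex;
  adj_sym : symmetric adj;
  adj_irrefl : irreflexive adj
}.

(* An edge is encoded as the two-element set of its endpoints. *)
Definition edges (G : sgraph) : {set {set G}} :=
  [set [set p.1; p.2] | p : G * G & adj p.1 p.2].

Definition isomorphic (G H : sgraph) : Prop :=
  exists2 f : G -> H, bijective f & {mono f : u v / adj u v}.

Section Subgraph.
Variables (G : sgraph) (A : {set {set G}}).

Definition sub_adj : rel G := fun u v => adj u v && ([set u; v] \in A).

Lemma sub_adj_sym : symmetric sub_adj.
Proof. by move=> u v; rewrite /sub_adj adj_sym setUC. Qed.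

Lemma sub_adj_irrefl : irreflexive sub_adj.
Proof. by move=> u; rewrite /sub_adj adj_irrefl. Qed.

(* The subgraph is spanning: it keeps every vertex of G, including those
   incident to no edge of A. *)
Definition subgraph : sgraph := SGraph sub_adj_sym sub_adj_irrefl.
End Subgraph.

Section Game.
Variable G : sgraph.

(* A strategy maps the opponent's previous moves, oldest first, to an edge.
   The codomain is {set G} rather than the subtype of edges, so that strategies
   exist on edgeless graphs; legality is imposed by red_strategy and
   blue_strategy below. *)
Definition strategy := seq {set G} -> {set G}.

Definition uncolored (r b : seq {set G}) : {set {set G}} :=
  edges G :\: ([set:: r] :|: [set:: b]).

Definition legal_position (r b : seq {set G}) : bool :=
  uniq (r ++ b) && all (fun e => e \in edges G) (r ++ b).

(* The first size b moves of A following sA: A's move number k.+1 is made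
   after seeing k moves of B. *)
Definition red_moves (sA : strategy) (b : seq {set G}) : seq {set G} :=
  [seq sA (take k b) | k <- iota 0 (size b)].

(* The answers of B following sB: B's move number k.+1 is made after seeing
   k.+1 moves of A. *)
Definition blue_moves (sB : strategy) (r : seq {set G}) : seq {set G} :=
  [seq sB (take k.+1 r) | k <- iota 0 (size r)].

(* The move prescribed by a strategy must be legal at every legal position
   reachable under it, as long as an uncolored edge remains. *)
Definition red_strategy (sA : strategy) : Prop :=
  forall b : seq {set G},
    let r := red_moves sA b in
    legal_position r b -> uncolored r b != set0 -> sA b \in uncolored r b.

(* Here a is A's latest move, not yet answered, and r are the earlier ones. *)
Definition blue_strategy (sB : strategy) : Prop :=
  forall (r : seq {set G}) (a : {set G}),
    let b := blue_moves sB r in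
    legal_position (rcons r a) b -> uncolored (rcons r a) b != set0 ->
    sB (rcons r a) \in uncolored (rcons r a) b.

(* The sequences of red and of blue edges after i rounds. *)
Fixpoint play (sA sB : strategy) (i : nat) : seq {set G} * seq {set G} :=
  if i is j.+1 then
    let: (r, b) := play sA sB j in
    let r' := rcons r (sA b) in
    (r', rcons b (sB r'))
  else ([::], [::]).

Definition red_edges (sA sB : strategy) (i : nat) : {set {set G}} :=
  [set:: (play sA sB i).1].

Definition blue_edges (sA sB : strategy) (i : nat) : {set {set G}} :=
  [set:: (play sA sB i).2].

Definition symmetric_strategy (sB : strategy) : Prop :=
  blue_strategy sB /\
  forall sA : strategy, red_strategy sA ->
  forall i : nat, i.*2 <= #|edges G| ->
    isomorphic (subgraph (red_edges sA sB i)) (subgraph (blue_edges sA sB i)).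
End Game.

Definition Symm (G : sgraph) : Prop :=
  exists sB : strategy G, symmetric_strategy sB.

Definition automorphism (G : sgraph) (phi : {perm G}) : Prop :=
  {mono phi : u v / adj u v}.

Definition involutory (G : sgraph) (phi : {perm G}) : bool := #[phi]%g == 2.

Definition edge_action (G : sgraph) (phi : {perm G}) (e : {set G}) : {set G} :=
  phi @: e.

Definition Auto (G : sgraph) : Prop :=
  exists phi : {perm G},
    [/\ automorphism phi, involutory phi
      & forall e : {set G}, e \in edges G -> edge_action phi e != e].

(* Main.v *)
From mathcomp Require Import all_boot all_fingroup.
Require Import Defs.

Set Implicit Arguments.
Unset Strict Implicit.
Unset Printing Implicit Defensive.

(** Let [tau] be a fixed-point-free involution of the edge set, and let B answer
each red edge [e] by [tau e]. After every round the red set [A] is disjoint from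
[tau A], the blue set. So B wins as soon as for every such [A] some permutation
of the vertices, which may depend on [A], acts on the edges in [A] as [tau].
If the graph is in Auto, one automorphism serves for all [A]. For the paw, a
triangle [abc] with a pendant edge [cd], take [tau] exchanging [ab] with [cd]
and [bc] with [ca]: the 4-cycle a -> d -> b -> c -> a acts as [tau] on all edges
but [ca], its inverse on all edges but [bc], and [A] never contains both. Yet
every automorphism of the paw fixes the edge [ab]. *)

Lemma edgesP (G : sgraph) (u v : G) : ([set u; v] \in edges G) = adj u v.
Proof.
apply/imsetP/idP => [[[x y] + uv]|uv]; last by exists (u, v); rewrite ?inE.
rewrite inE /= => xy.
have xNy : x != y by apply: contraTneq xy => ->; rewrite adj_irrefl.
have [] : (u \in [set x; y]) /\ (v \in [set x; y]) by rewrite -uv set21 set22.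
have [] : (x \in [set u; v]) /\ (y \in [set u; v]) by rewrite uv set21 set22.
(* Of the four ways to match endpoints, two collapse the edge to one vertex, contradicting [xNy];
   the swapped one uses symmetry of [adj]. *)
move=> xuv yuv /set2P[] uE /set2P[] vE; subst u v => //.
- by move: yuv; rewrite !inE orbb eq_sym (negbTE xNy).
- by rewrite adj_sym.
- by move: xuv; rewrite !inE orbb (negbTE xNy).
Qed.

Lemma imset_pair (aT rT : finType) (f : aT -> rT) x y :
  f @: [set x; y] = [set f x; f y].
Proof. by rewrite imsetU1 imset_set1. Qed.

(** [f] need not be an automorphism of [G]: as [f] is injective on vertex sets, a pair lies in [A]
    exactly when its image lies in the image of [A], and that image is [tau @: A]. *)
Lemma isomorphic_subgraph (G : sgraph) (A : {set {set G}})
    (tau : {set G} -> {set G}) (f : {perm G}) :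
    A \subset edges G -> {in A, forall e, tau e \in edges G} ->
    {in A, forall e : {set G}, f @: e = tau e} ->
  isomorphic (subgraph A) (subgraph (tau @: A)).
Proof.
move=> AE tauE ftau.
have sub_adjE (B : {set {set G}}) u v :
    B \subset edges G -> sub_adj B u v = ([set u; v] \in B).
  move=> /subsetP BE; rewrite /sub_adj andb_idl // => /BE.
  by rewrite edgesP.
exists f; first by exists (f^-1)%g => x; rewrite ?permK ?permKV.
move=> u v /=; rewrite !sub_adjE //; last by apply/subsetP => _ /imsetP[e /tauE ? ->].
rewrite -(eq_in_imset ftau).
by rewrite -imset_pair mem_imset //; apply: imset_inj; apply: perm_inj.
Qed.

Lemma red_moves_rcons (G : sgraph) (sA : strategy G) b x :
  red_moves sA (rcons b x) = rcons (red_moves sA b) (sA b).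
Proof.
rewrite /red_moves size_rcons -addn1 iotaD map_cat /= add0n cats1 -[rcons b x]cats1 take_size_cat //.
congr rcons; apply/eq_in_map => k; rewrite mem_iota => /andP[_ kb].
by rewrite takel_cat // ltnW.
Qed.

Lemma legal_rcons_blue (G : sgraph) (r b : seq {set G}) c :
  legal_position r b -> c \in uncolored r b -> legal_position r (rcons b c).
Proof.
case/andP=> rb_uniq rbE; rewrite !inE => /andP[crb cE].
by rewrite /legal_position -rcons_cat rcons_uniq all_rcons mem_cat crb rb_uniq cE.
Qed.

Lemma legal_rcons_red (G : sgraph) (r b : seq {set G}) a :
  legal_position r b -> a \in uncolored r b -> legal_position (rcons r a) b.
Proof.
move=> legal_rb /(legal_rcons_blue legal_rb).
(* Legality ignores who colored which edge, so a new red edge may be treated as a new blue one. *)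
have pE : perm_eq (rcons r a ++ b) (r ++ rcons b a).
  by rewrite cat_rcons perm_cat2l perm_sym perm_rcons.
by rewrite /legal_position (perm_uniq pE) (perm_all _ pE).
Qed.

Lemma uncolored_neq0 (G : sgraph) (r b : seq {set G}) :
  size r + size b < #|edges G| -> uncolored r b != set0.
Proof.
apply: contraTneq => /eqP; rewrite setD_eq0 -leqNgt => /subset_leq_card /leq_trans -> //.
rewrite -size_cat; apply: leq_trans (card_size (r ++ b)).
by apply/subset_leq_card/subsetP => e; rewrite !inE mem_cat.
Qed.

Section Pairing.
Variables (G : sgraph) (tau : {set G} -> {set G}).
Hypothesis tauE : {in edges G, forall e, tau e \in edges G}.
Hypothesis tauK : {in edges G, involutive tau}.
Hypothesis tau_neq : {in edges G, forall e, tau e != e}.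

(** The default [set0] concerns only the empty history, which B never faces. *)
Definition pairing_strategy : strategy G := fun r => tau (last set0 r).

Lemma blue_moves_pairing r : blue_moves pairing_strategy r = map tau r.
Proof.
apply: (@eq_from_nth _ set0) => [|k]; rewrite !size_map size_iota // => kr.
rewrite (nth_map 0) ?size_iota // nth_iota // (nth_map set0) //.
by rewrite /pairing_strategy add0n (take_nth set0) // last_rcons.
Qed.

(** If [tau a] were an earlier red edge, its answer [a] would already be blue; if it were blue, it
    would answer an earlier red edge, equal to [a] by involutivity. *)
Lemma pairing_fresh r a : legal_position (rcons r a) (map tau r) ->
  tau a \in uncolored (rcons r a) (map tau r).
Proof.
case/andP; rewrite cat_uniq rcons_uniq all_cat all_rcons.
case/and3P=> /andP[ar _] /hasPn dis _ /andP[/andP[aE /allP rE] _].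
rewrite !inE tauE // andbT mem_rcons inE negb_or negb_or tau_neq //=.
apply/andP; split.
  apply/negP => /(map_f tau); rewrite tauK // => /dis.
  by rewrite /= mem_rcons mem_head.
apply/mapP => -[x xr tax]; case/negP: ar.
by rewrite -[a]tauK // tax tauK // rE.
Qed.

(** The clause on [red_moves] is carried through the induction because [red_strategy] guarantees
    legality only at positions of that form. *)
Lemma play_pairing (sA : strategy G) i :
    red_strategy sA -> i.*2 <= #|edges G| ->
  let r := (play sA pairing_strategy i).1 in
  [/\ play sA pairing_strategy i = (r, map tau r), size r = i,
      red_moves sA (map tau r) = r & legal_position r (map tau r)].
Proof.
move=> sA_red; elim: i => [|i IH] // iE /=.
have /IH : i.*2 <= #|edges G| by rewrite (leq_trans _ iE) // leq_double.
case: (play _ _ i) => r b /= [[->] size_r red_r legal_r].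
have sA_legal : sA (map tau r) \in uncolored r (map tau r).
  have := sA_red (map tau r); rewrite red_r; apply=> //.
  by apply: uncolored_neq0; rewrite size_map size_r addnn (leq_trans _ iE) // doubleS.
have legal_r' := legal_rcons_red legal_r sA_legal.
rewrite /pairing_strategy last_rcons map_rcons; split=> //.
- by rewrite size_rcons size_r.
- by rewrite red_moves_rcons red_r.
- exact: legal_rcons_blue legal_r' (pairing_fresh legal_r').
Qed.

Lemma Symm_pairing :
    (forall A : {set {set G}}, A \subset edges G -> [disjoint A & tau @: A] ->
      exists f : {perm G}, {in A, forall e : {set G}, f @: e = tau e}) ->
  Symm G.
Proof.
move=> tau_perm; exists pairing_strategy; split=> [r a /=|sA sA_red i iE].
  rewrite blue_moves_pairing => legal_r _.
  by rewrite /pairing_strategy last_rcons pairing_fresh.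
have [] := play_pairing sA_red iE; rewrite /red_edges /blue_edges.
set r := (play _ _ _).1 => -> _ _ /= /andP[].
rewrite cat_uniq all_cat => /and3P[_ /hasPn dis _] /andP[/allP rE _].
set A := [set:: r].
have AE : A \subset edges G by apply/subsetP => e; rewrite inE => /rE.
have -> : [set:: map tau r] = tau @: A.
  apply/setP => e; rewrite inE; apply/mapP/imsetP => -[x xr ->]; exists x => //.
    by rewrite inE.
  by rewrite inE in xr.
have [|f fE] := tau_perm A AE.
  rewrite disjoint_sym disjoint_subset; apply/subsetP => _ /imsetP[e eA ->].
  by rewrite !inE in eA *; apply/dis/map_f.
by apply: (isomorphic_subgraph AE _ fE) => e eA; apply/tauE/(subsetP AE).
Qed.

End Pairing.

Lemma Auto_Symm (G : sgraph) : Auto G -> Symm G.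
Proof.
case=> phi [phi_adj phi2 phi_neq]; apply: (@Symm_pairing _ (edge_action phi)) => //.
- move=> _ /imsetP[[u v] uv ->]; rewrite inE /= in uv.
  by rewrite /edge_action imset_pair edgesP phi_adj.
- move=> e _; rewrite /edge_action -imset_comp -[RHS]imset_id.
  apply: eq_imset => x /=; rewrite -permM (_ : phi * phi = 1)%g ?perm1 //.
  by rewrite -(expg_order phi) (eqP phi2).
- by move=> A _ _; exists phi.
Qed.

(** The vertices a, d, b, c are consecutive corners of a square, so that [paw_rot] below is a
    quarter turn. *)
Definition pa := (false, false).
Definition pb := (true, true).
Definition pc := (false, true).
Definition pd := (true, false).

Definition paw_adj : rel (bool * bool) := fun u v =>
  (u != v) && [|| u == pc, v == pc | (u != pd) && (v != pd)].

Lemma paw_adj_sym : symmetric paw_adj.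
Proof. by move=> [[] []] [[] []]. Qed.

Lemma paw_adj_irrefl : irreflexive paw_adj.
Proof. by move=> [[] []]. Qed.

Definition paw : sgraph := SGraph paw_adj_sym paw_adj_irrefl.

Definition ab : {set paw} := [set pa; pb].
Definition bc : {set paw} := [set pb; pc].
Definition ca : {set paw} := [set pc; pa].
Definition cd : {set paw} := [set pc; pd].

Lemma paw_edge_ind (P : {set paw} -> Prop) :
  P ab -> P bc -> P ca -> P cd -> forall e, e \in edges paw -> P e.
Proof.
move=> Pab Pbc Pca Pcd _ /imsetP[[u v] + ->]; rewrite inE /=.
by case: u v => [[] []] [[] []] //= _; rewrite // setUC.
Qed.

(** The tests identify the edge: only [cd] contains d, only [ab] avoids c, and a tells [ca] from
    [bc]. *)
Definition paw_tau (e : {set paw}) : {set paw} :=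
  if pd \in e then ab else if pc \notin e then cd else if pa \in e then bc else ca.

Lemma paw_tauE :
  (paw_tau ab = cd) * (paw_tau bc = ca) * (paw_tau ca = bc) * (paw_tau cd = ab).
Proof. by rewrite /paw_tau /ab /bc /ca /cd !inE. Qed.

Lemma paw_tau_edges : {in edges paw, forall e, paw_tau e \in edges paw}.
Proof. by apply: paw_edge_ind; rewrite paw_tauE edgesP. Qed.

Lemma paw_tauK : {in edges paw, involutive paw_tau}.
Proof. by apply: paw_edge_ind; rewrite !paw_tauE. Qed.

Lemma paw_tau_neq : {in edges paw, forall e, paw_tau e != e}.
Proof.
(* The vertex a lies in exactly one edge of each pair exchanged by [paw_tau]. *)
by apply: paw_edge_ind; rewrite paw_tauE; apply/eqP => /setP/(_ pa); rewrite !inE.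
Qed.

Definition paw_rot (u : paw) : paw := (~~ u.2, u.1).

Lemma paw_rot_inj : injective paw_rot.
Proof. by move=> [[] []] [[] []]. Qed.

Definition paw_perm : {perm paw} := perm paw_rot_inj.

Lemma paw_permE : (paw_perm pa = pd) * (paw_perm pd = pb) *
  (paw_perm pb = pc) * (paw_perm pc = pa).
Proof. by rewrite !permE. Qed.

Lemma paw_permVE : (paw_perm^-1 pd = pa)%g * (paw_perm^-1 pb = pd)%g *
  (paw_perm^-1 pc = pb)%g * (paw_perm^-1 pa = pc)%g.
Proof. by do !split; apply: (canLR (permK _)); rewrite paw_permE. Qed.

Lemma Symm_paw : Symm paw.
Proof.
apply: (Symm_pairing paw_tau_edges paw_tauK paw_tau_neq) => A AE dis.
have [caA|caNA] := boolP (ca \in A).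
  (* [bc] answers the red edge [ca], so it is blue. *)
  have bcNA : bc \notin A.
    by rewrite (disjointFl dis) // -(paw_tauE.1.2); apply: imset_f.
  exists paw_perm^-1%g => e /[dup] /(subsetP AE); move: e.
  apply: paw_edge_ind => [_|/(negP bcNA)//|_|_];
    by rewrite imset_pair !paw_permVE paw_tauE // setUC.
exists paw_perm => e /[dup] /(subsetP AE); move: e.
apply: paw_edge_ind => [_|_|/(negP caNA)//|_];
  by rewrite imset_pair !paw_permE paw_tauE // setUC.
Qed.

(** The degrees 3 of c and 1 of d are unique, so an automorphism fixes both vertices and preserves
    the remaining pair, the edge [ab]. *)
Lemma not_Auto_paw : ~ Auto paw.
Proof.
case=> phi [phi_adj _ /(_ ab)]; rewrite edgesP /edge_action imset_pair => /(_ isT).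
move: (phi_adj pa pb) (phi_adj pa pc) (phi_adj pa pd).
move: (phi_adj pb pc) (phi_adj pb pd) (phi_adj pc pd).
case: (phi pc) => [[] []]; case: (phi pd) => [[] []] //=;
  case: (phi pa) => [[] []] //=; case: (phi pb) => [[] []] //=.
(* Two cases survive: the identity and the exchange of a and b. *)
all: by rewrite ?eqxx // setUC eqxx.
Qed.

Theorem theorem1 :
  (forall G : sgraph, Auto G -> Symm G) /\
  (exists G : sgraph, Symm G /\ ~ Auto G).
Proof.
split; first exact: Auto_Symm.
by exists paw; split; [apply: Symm_paw | apply: not_Auto_paw].
Qed.
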